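(* Let $k\ge 2$ and $n\ge 2$ be integers. Suppose $n^2\le k(n-1)+1$ and suppose $\overline{a}=(k-1)/n$ is an integer. Then there is an optimal $\mathsf{OA}_{\lambda}(k,n)$, where \[ \lambda=\binom{k-2}{\overline{a}-1}(n-1)^{k-\overline{a}-1}. \]
   Context: For integers $k\ge 2$, $n\ge 2$, $\lambda\ge 1$, an orthogonal array $\mathsf{OA}_{\lambda}(k,n)$ is a $\lambda n^2$ by $k$ array with entries from a set $X$ of cardinality $n$ such that, within any two distinct columns, every ordered pair of symbols from $X$ occurs in exactly $\lambda$ rows (rows may be repeated). An $\mathsf{OA}_{\lambda}(k,n)$ is optimal if it contains a row that is repeated exactly $m=\frac{\lambda n^2}{k(n-1)+1}$ times (in particular this number is a positive integer). *)

(* Defs.v *)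
From mathcomp Require Import all_boot all_order all_algebra.

Set Implicit Arguments.
Unset Strict Implicit.
Unset Printing Implicit Defensive.

Definition orthogonal_array (lambda k n : nat) (X : finType)
    (A : 'M[X]_(lambda * n ^ 2, k)) : Prop :=
  [/\ 2 <= k, 2 <= n, 1 <= lambda, #|X| = n &
      forall j1 j2 : 'I_k, j1 != j2 -> forall x y : X,
        #|[set i | (A i j1 == x) && (A i j2 == y)]| = lambda].

Definition row_multiplicity (b k : nat) (X : finType) (A : 'M[X]_(b, k))
    (r : 'I_b) : nat :=
  #|[set i | row i A == row r A]|.

(* The divisibility clause makes the quotient %/ exact; the common value is
   positive since the row r is counted in its own multiplicity. *)
Definition optimal_orthogonal_array (lambda k n : nat) (X : finType)
    (A : 'M[X]_(lambda * n ^ 2, k)) : Prop :=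
  [/\ orthogonal_array A,
      k * (n - 1) + 1 %| lambda * n ^ 2 &
      exists r, row_multiplicity A r = lambda * n ^ 2 %/ (k * (n - 1) + 1)].

(* Main.v *)
Require Import Defs.
From mathcomp Require Import all_boot all_order all_algebra.
From mathcomp Require Import zify ring.

Set Implicit Arguments.
Unset Strict Implicit.
Unset Printing Implicit Defensive.

(** Fix a symbol z among n symbols, put q = n - 1, and let k = a * n + 1 with
    a > 0.  The array lists once every word of length k that has exactly a
    entries equal to z, and then m copies of the constant word z.

    Why two columns are balanced.  If a pair (x, y) of symbols contains c
    copies of z, the words of the first kind that show it in two given columns
    are obtained by distributing a - c further z's over the other k - 2 columns
    and filling the rest with the q other symbols, so that
      N_c = 'C(k - 2, a - c) * q ^ (k - 2 - (a - c))
    of them do, or none if c > a ([card_words_at_pair]).  By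
    definition N_1 is the desired index lambda.  The length k = a * n + 1 is exactly the one for which N_0 = N_1
    ([binomial_balance]), as 'C(k - 2, a) = 'C(k - 2, a - 1) * q.  Only the pair
    (z, z) is deficient, and the constant word affects only this pair: taking
    m = lambda - N_2 repairs it.

    Why the array is optimal.  The absorption identity for binomials gives
    (a * q + 1) * N_2 = (a - 1) * q * lambda ([binomial_deficit]), hence
    (a * q + 1) * m = n * lambda; since k * q + 1 = n * (a * q + 1), this says
    m * (k * q + 1) = lambda * n ^ 2.  The constant word has k > a entries z, so
    it is not of the first kind and is repeated exactly m times. *)

(** * Counting words by the positions of a symbol *)

(** Off D the word is forced; on D one chooses the t places of z and then any
    of the #|X| - 1 other symbols at each remaining place.  The sum over the
    choices is the sum over the fibres of the map sending w to its z-places. *)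
Lemma card_words_extending (J X : finType) (z : X) (D : {set J}) (g : J -> X)
    (t : nat) :
  #|[set w : {ffun J -> X} | [forall j, (j \notin D) ==> (w j == g j)]
        & #|[set j in D | w j == z]| == t]|
  = 'C(#|D|, t) * #|X|.-1 ^ (#|D| - t).
Proof.
pose places (w : {ffun J -> X}) := [set j in D | w j == z].
rewrite -sum1_card (partition_big places
  (fun Z : {set J} => (Z \subset D) && (#|Z| == t))) /=; last first.
  by move=> w; rewrite inE => /andP[_ ->]; rewrite andbT;
     apply/subsetP=> j; rewrite inE => /andP[].
rewrite -(cards_draws D t) -sum_nat_const.
apply: eq_big => [Z | Z /andP[sZD /eqP cZ]]; first by rewrite inE.
pose F j : pred X :=
  if j \in Z then pred1 z else if j \in D then predC1 z else pred1 (g j).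
rewrite sum1_card (eq_card (B := family F)); last first.
  move=> w; rewrite -topredE /= inE.
  apply/andP/familyP => [[/andP[/forallP off _] /eqP defZ] j | onF].
    rewrite /F -defZ inE; have := off j; case: (boolP (j \in D)) => //= _.
    by case: (boolP (w j == z)).
  have defZ : places w = Z.
    apply/setP=> j; have := onF j; rewrite /F inE.
    case: (boolP (j \in Z)) => [jZ /eqP -> | _].
      by rewrite (subsetP sZD) ?eqxx.
    by case: (boolP (j \in D)) => //= _; rewrite !inE => /negbTE.
  split; last by apply/eqP.
  rewrite -/(places w) defZ cZ eqxx andbT; apply/forallP => j; apply/implyP.
  move=> jD; have := onF j; rewrite /F (negbTE jD).
  by case: (boolP (j \in Z)) => // /(subsetP sZD); rewrite (negbTE jD).
rewrite card_family foldrE big_image /=.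
rewrite (eq_bigr (fun j => if j \in D :\: Z then #|X|.-1 else 1)); last first.
  move=> j _; rewrite /F inE; case: (boolP (j \in Z)) => [_|_]; first exact: card1.
  by case: (j \in D); rewrite ?card1 //= cardC1.
by rewrite -big_mkcond prod_nat_const cardsD (setIidPr sZD) cZ.
Qed.

Definition words_with (k : nat) (X : finType) (z : X) (a : nat) :
    {set {ffun 'I_k -> X}} :=
  [set w : {ffun 'I_k -> X} | #|[set j | w j == z]| == a].

(** The case where D omits two places: the prescribed pair already uses up
    (x == z) + (y == z) of the a occurrences of z. *)
Lemma card_words_at_pair (k : nat) (X : finType) (z : X) (a : nat)
    (j1 j2 : 'I_k) (x y : X) (c := (x == z) + (y == z)) :
  j1 != j2 ->
  #|[set w in words_with k z a | (w j1 == x) && (w j2 == y)]|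
  = if c <= a then 'C(k - 2, a - c) * #|X|.-1 ^ (k - 2 - (a - c)) else 0.
Proof.
move=> j12; have j21 : j2 != j1 by rewrite eq_sym.
pose D := ~: [set j1; j2].
have cD : #|D| = k - 2 by rewrite cardsCs setCK card_ord cards2 j12.
pose g j := if j == j1 then x else y.
have offD (w : {ffun 'I_k -> X}) :
    [forall j, (j \notin D) ==> (w j == g j)] = (w j1 == x) && (w j2 == y).
  apply/forallP/andP => [off | [e1 e2] j].
    have := off j1; have := off j2; rewrite /g !inE !eqxx orbT /=.
    by rewrite (negbTE j21) => -> ->.
  rewrite !inE negbK /g; apply/implyP => /orP[] /eqP ->; rewrite ?eqxx //.
  by rewrite (negbTE j21).
have zerosD (w : {ffun 'I_k -> X}) : (w j1 == x) && (w j2 == y) ->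
    #|[set j | w j == z]| = c + #|[set j in D | w j == z]|.
  case/andP=> /eqP e1 /eqP e2.
  rewrite (cardsD1 j1) (cardsD1 j2) !inE j21 /= e1 e2 addnA.
  congr (_ + _); apply: eq_card => j; rewrite !inE negb_or.
  by rewrite andbCA andbA.
case: leqP => [ca | ac]; last first.
  apply/eqP; rewrite cards_eq0; apply/eqP/setP => w; rewrite !inE.
  by apply/negP => /andP[/eqP cw /zerosD]; lia.
rewrite -cD -(card_words_extending z D g); apply: eq_card => w.
rewrite !inE offD andbC; case: (boolP ((w j1 == x) && (w j2 == y))) => //= /zerosD ->.
by rewrite -{1}(subnKC ca) eqn_add2l.
Qed.

(** * Arithmetic of the index *)

(** N_0 = N_1, written for a + 1 occurrences of z, where k - 2 = (a + 1) * q + a.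
    Choosing one more place for z multiplies the binomial by
    (k - 2 - a) / (a + 1) = q, which pays for the lost factor q. *)
Lemma binomial_balance (a q : nat) : 0 < q ->
  'C(a.+1 * q + a, a.+1) * q ^ (a.+1 * q).-1 = 'C(a.+1 * q + a, a) * q ^ (a.+1 * q).
Proof.
move=> q0; have aq0 : 0 < a.+1 * q by rewrite muln_gt0.
have /eqP := mul_bin_left (a.+1 * q + a) a.
rewrite addnK -mulnA eqn_pmul2l // => /eqP ->.
have -> : q ^ (a.+1 * q) = q * q ^ (a.+1 * q).-1 by rewrite -expnS prednK.
ring.
Qed.

(** The relation between N_2 and N_1, written for a + 2 occurrences of z, where
    k - 2 = (a + 2) * q + a + 1; a single occurrence makes N_2 vanish and
    is left out. *)
Lemma binomial_deficit (a q : nat) :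
  (a.+2 * q).+1 * ('C(a.+2 * q + a.+1, a) * q ^ (a.+2 * q).+1)
  = a.+1 * q * ('C(a.+2 * q + a.+1, a.+1) * q ^ (a.+2 * q)).
Proof.
have E := mul_bin_left (a.+2 * q + a.+1) a.
have F : a.+2 * q + a.+1 - a = (a.+2 * q).+1 by rewrite addnS subSn ?addnK ?leq_addl.
rewrite F in E; rewrite mulnA -E expnS; ring.
Qed.

(** * Arrays given by a list of words *)

Definition array_of (k b : nat) (X : finType) (w0 : {ffun 'I_k -> X})
    (s : seq {ffun 'I_k -> X}) : 'M[X]_(b, k) :=
  \matrix_(i, j) nth w0 s i j.

Lemma card_nth_count (T : Type) (w0 : T) (s : seq T) (b : nat) (P : pred T) :
  size s = b -> #|[set i : 'I_b | P (nth w0 s i)]| = count P s.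
Proof.
move=> <-; rewrite -sum1_count (big_nth w0) big_mkord -sum1_card.
by apply: eq_bigl => i; rewrite inE.
Qed.

Lemma count_enum (T : finType) (A : {set T}) (P : pred T) :
  count P (enum A) = #|[set x in A | P x]|.
Proof.
rewrite -sum1_count big_enum_cond -sum1_card.
by apply: eq_bigl => x; rewrite inE.
Qed.

(** Each word shows exactly one of the #|X| ^ 2 pairs in columns j1 and j2. *)
Lemma size_balanced (k lambda : nat) (X : finType) (j1 j2 : 'I_k)
    (s : seq {ffun 'I_k -> X}) :
  (forall x y,
     count (fun w : {ffun 'I_k -> X} => (w j1 == x) && (w j2 == y)) s = lambda) ->
  size s = lambda * #|X| ^ 2.
Proof.
move=> bal; rewrite -sum1_size.
rewrite (partition_big (fun w : {ffun 'I_k -> X} => (w j1, w j2)) predT) //=.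
under eq_bigr => p _ do rewrite sum1_count (bal p.1 p.2).
by rewrite sum_nat_const card_prod mulnC mulnn.
Qed.

(** The list need not be known to have lambda * n ^ 2 entries: its length
    follows from the balance of a single pair of columns. *)
Lemma optimal_array_of (k n lambda m : nat) (X : finType)
    (s : seq {ffun 'I_k -> X}) (w0 : {ffun 'I_k -> X}) :
  2 <= k -> 2 <= n -> 1 <= lambda -> #|X| = n ->
  (forall j1 j2, j1 != j2 -> forall x y,
     count (fun w : {ffun 'I_k -> X} => (w j1 == x) && (w j2 == y)) s = lambda) ->
  count_mem w0 s = m -> m * (k * (n - 1) + 1) = lambda * n ^ 2 ->
  optimal_orthogonal_array (array_of (lambda * n ^ 2) w0 s).
Proof.
move=> k2 n2 l1 cX bal cnt dm.
have sz : size s = lambda * n ^ 2.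
  rewrite -cX; apply: (@size_balanced _ _ _ (Ordinal (ltnW k2)) (Ordinal k2)).
  exact: bal.
have m_gt0 : 0 < m.
  by case: (posnP m) dm => // -> /esym/eqP; rewrite mul0n muln_eq0 expn_eq0; lia.
split.
- split=> // j1 j2 j12 x y; rewrite -[RHS](bal _ _ j12 x y).
  rewrite -(card_nth_count w0 _ sz); apply: eq_card => i.
  by rewrite !inE !mxE.
- by rewrite -dm dvdn_mull.
have w0s : w0 \in s by rewrite -has_pred1 has_count cnt.
have r_lt : index w0 s < lambda * n ^ 2 by rewrite -sz index_mem.
exists (Ordinal r_lt); rewrite -[in RHS]dm mulnK ?addn1 // -cnt.
rewrite -(card_nth_count w0 _ sz); apply: eq_card => i; rewrite !inE /=.
apply/eqP/eqP => [/rowP E | E]; last first.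
  by apply/rowP => j; rewrite !mxE /= E nth_index.
by apply/ffunP => j; have := E j; rewrite !mxE /= nth_index.
Qed.

(** * The construction *)

Theorem theorem4p1 (k n : nat) (hk : 2 <= k) (hn : 2 <= n)
    (hkn : n ^ 2 <= k * (n - 1) + 1) (ha : n %| k - 1) :
  let a := (k - 1) %/ n in
  let lambda := 'C(k - 2, a - 1) * (n - 1) ^ (k - a - 1) in
  exists (X : finType) (A : 'M[X]_(lambda * n ^ 2, k)),
    optimal_orthogonal_array A.
Proof.
move=> a lambda.
have defk : k - 1 = a * n by rewrite divnK.
have a_gt0 : 0 < a by case: (posnP a) defk => // ->; lia.
(* Coordinates without truncated subtraction: a = e + 1 and n = q + 1. *)
have [e defa] : exists e, a = e.+1 by exists a.-1; rewrite prednK.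
have [q defn] : exists q, n = q.+1 by exists n.-1; lia.
have q_gt0 : 0 < q by lia.
have lamE : lambda = 'C(k - 2, e) * q ^ (k - a - 1).
  by rewrite /lambda defa defn !subn1.
clearbody a lambda; clear hkn ha; subst a n.
have k2E : k - 2 = e.+1 * q + e by move: defk; rewrite mulnS; lia.
have expE : k - e.+1 - 1 = e.+1 * q by lia.
rewrite k2E expE in lamE.
have lam_gt0 : 0 < lambda by rewrite lamE muln_gt0 bin_gt0 leq_addl expn_gt0 q_gt0.
pose z : 'I_q.+1 := Ordinal (ltnW hn).
(* The words of the first kind showing (z, z); none if there is a single z. *)
pose N2 := if 2 <= e.+1 then 'C(k - 2, e.+1 - 2) * q ^ (k - 2 - (e.+1 - 2)) else 0.
have deficit : (e.+1 * q).+1 * N2 = e * q * lambda.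
  rewrite /N2 lamE k2E; case: (e) => [|d] /=; first by rewrite muln0 mul0n.
  rewrite -binomial_deficit !subSS subn0; congr (_ * (_ * _ ^ _)); lia.
have N2_le : N2 <= lambda.
  rewrite -(leq_pmul2l (ltn0Sn (e.+1 * q))) deficit leq_mul2r; apply/orP; right.
  by rewrite mulSn; lia.
pose m := lambda - N2.
have mE : m * (k * (q.+1 - 1) + 1) = lambda * q.+1 ^ 2.
  have -> : k * (q.+1 - 1) + 1 = q.+1 * (e.+1 * q).+1.
    have -> : k = e.+1 * q.+1 + 1 by lia.
    lia.
  have key : m * (e.+1 * q).+1 = lambda * q.+1.
    by rewrite /m mulnBl [N2 * _]mulnC deficit; nia.
  by rewrite mulnCA key mulnCA mulnn.
pose w0 : {ffun 'I_k -> 'I_q.+1} := [ffun=> z].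
exists 'I_q.+1, (array_of _ w0 (enum (words_with k z e.+1) ++ nseq m w0)).
apply: (optimal_array_of (m := m)) => //; first exact: card_ord.
- move=> j1 j2 j12 x y; rewrite count_cat count_nseq count_enum.
  rewrite card_words_at_pair // card_ord !ffunE ![z == _]eq_sym.
  case: (x == z); case: (y == z) => /=.
  + by rewrite mul1n -/N2 subnKC.
  + by rewrite mul0n addn0 k2E lamE subn1 addnK.
  + by rewrite mul0n addn0 k2E lamE subn1 addnK.
  rewrite mul0n addn0 k2E lamE subn0 -binomial_balance //.
  by congr (_ * _ ^ _); lia.
rewrite count_cat count_nseq /= eqxx mul1n count_enum.
rewrite (_ : [set w in _ | _] = set0) ?cards0 //; apply/setP => w; rewrite !inE.
apply/negP => /andP[/eqP cw /eqP ww]; move: cw; rewrite ww.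
rewrite (_ : [set j | _] = setT) ?cardsT ?card_ord; first by nia.
by apply/setP => j; rewrite !inE ffunE eqxx.
Qed.
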